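(* There is a universal constant $C$ such that the following holds. Fix $\ell\ge2$, assume $n$ is a (positive) multiple of $\ell$, and let $\kappa=(n/\ell,\dots,n/\ell)\in\mathbb{N}_+^\ell$. If $f:\mathcal{U}_\kappa\to\{0,1\}$ has degree at most $k$, then $f$ is an $\ell^{Ck}$-junta.
   Context: The multislice is $\mathcal{U}_\kappa=\{u\in[\ell]^n : u \text{ has exactly } \kappa_i \text{ coordinates equal to } i,\ \forall i\in[\ell]\}$. A function $g$ on $\mathcal{U}_\kappa$ is an $m$-junta if there is $J\subseteq[n]$ with $|J|\le m$ such that $g(u)$ depends only on $(u_j)_{j\in J}$. A function $f:\mathcal{U}_\kappa\to\mathbb{R}$ has degree at most $k$ ($k\in\mathbb{N}$) if it is a linear combination of ($\mathbb{R}$-valued) $k$-juntas on $\mathcal{U}_\kappa$. *)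

(* Defs.v *)
(* MathComp world; the type of real numbers is an arbitrary R : realType. *)
From HB Require Import structures.
From mathcomp Require Import all_boot all_order all_algebra.
From mathcomp Require Import reals.
Set Implicit Arguments.
Unset Strict Implicit.
Unset Printing Implicit Defensive.
Import Order.TTheory GRing.Theory Num.Theory.
Local Open Scope ring_scope.

(* The alphabet [ell] = {1, ..., ell} and the coordinate set [n] are relabelled
   as the ordinals 'I_ell and 'I_n (starting from 0). *)
Record multislice (n ell : nat) (kappa : 'I_ell -> nat) := Multislice {
  msval :> {ffun 'I_n -> 'I_ell};
  _ : [forall i, #|[set j | msval j == i]| == kappa i]
}.

HB.instance Definition _ n ell kappa :=
  [isSub for @msval n ell kappa].
HB.instance Definition _ n ell kappa :=
  [Finite of @multislice n ell kappa by <:].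

Definition is_junta (n ell : nat) (kappa : 'I_ell -> nat) (T : Type) (m : nat)
    (g : multislice n kappa -> T) : Prop :=
  exists J : {set 'I_n}, (#|J| <= m)%N /\
    forall u v : multislice n kappa,
      (forall j, j \in J -> u j = v j) -> g u = g v.

Definition degree_at_most (R : realType) (n ell : nat) (kappa : 'I_ell -> nat)
    (k : nat) (f : multislice n kappa -> R) : Prop :=
  exists (N : nat) (c : 'I_N -> R) (g : 'I_N -> multislice n kappa -> R),
    (forall i, is_junta k (g i)) /\
    forall u, f u = \sum_(i < N) c i * g i u.

(* Main.v *)
(* A Boolean function of degree at most [k] restricts, along a matching of the
   coordinates, to a Boolean function of degree at most [2k] on a cube, whose
   total influence is O(k); averaging over [n] matchings that together cover all
   pairs, the sum over pairs (i, j) of P[f <> f^(ij)] is O(kn).  On the other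
   hand, if f <> f^(ij) somewhere, then this happens with probability at least
   (8 ell^2)^-k.  Hence some coordinate [i] has few partners [j] for which
   f <> f^(ij).  Let J be the set of these partners: transpositions inside the
   complement of J are products of transpositions (i j) fixing f, and any two
   points of the multislice that agree on J differ by a permutation of the
   complement of J, so f depends only on J.  If n / ell < 4k, the set of all
   coordinates is small enough. *)
Require Import Defs.
From mathcomp Require Import all_boot all_order all_algebra.
From mathcomp Require Import all_fingroup.
From mathcomp Require Import reals zify ring.
Set Implicit Arguments.
Unset Strict Implicit.
Unset Printing Implicit Defensive.
Import Order.TTheory GRing.Theory Num.Theory.
Local Open Scope ring_scope.

(** * Fourier analysis on the Boolean cube *)

Section Cube.
Variables (R : realType) (I : finType).
Implicit Types x y S : {ffun I -> bool}.

Definition flip x i : {ffun I -> bool} := [ffun j => x j (+) (j == i)].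

Lemma flipK i : involutive (flip^~ i).
Proof. by move=> x; apply/ffunP=> j; rewrite !ffunE -addbA addbb addbF. Qed.

(** The character of the cube with index set [y], at the point [x]. Index sets are encoded as
    points, which makes the formula symmetric. *)
Definition walsh x y : R := \prod_i (-1) ^+ (x i && y i).

Lemma walshC x y : walsh x y = walsh y x.
Proof. by apply: eq_bigr => i _; rewrite andbC. Qed.

Lemma walsh_flip x y i : walsh (flip x i) y = (-1) ^+ y i * walsh x y.
Proof.
rewrite /walsh (bigD1 i) //= [in RHS](bigD1 i) //= mulrA; congr (_ * _).
  rewrite ffunE eqxx; case: (x i); case: (y i);
    by rewrite /= ?mul1r ?mulr1 ?mulrNN ?mulr1.
by apply: eq_bigr => j ji; rewrite ffunE (negbTE ji) addbF.
Qed.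

Lemma walsh_sqr x y : walsh x y * walsh x y = 1.
Proof. by rewrite -big_split big1 // => i _ /=; rewrite -signr_addb addbb. Qed.

Lemma sum_flip_odd i (F : {ffun I -> bool} -> R) :
  (forall x, F (flip x i) = - F x) -> \sum_x F x = 0.
Proof.
move=> oddF; apply/eqP; rewrite -[_ == 0](mulrn_eq0 _ 2) mulr2n.
rewrite [X in X + _](reindex_inj (inv_inj (flipK i))) -big_split /=.
by rewrite big1 // => x _; rewrite oddF addNr.
Qed.

Lemma walsh_orthogonal x y :
  \sum_S walsh S x * walsh S y = if x == y then (2 ^ #|I|)%:R else 0.
Proof.
case: eqVneq => [<-|].
  rewrite (eq_bigr (fun=> 1)) => [|S _]; last exact: walsh_sqr.
  by rewrite sumr_const card_ffun card_bool.
move=> xDy; have [i xyi] : exists i, x i != y i.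
  apply/existsP; rewrite -negb_forall; apply: contraNN xDy => /forallP e.
  by apply/eqP/ffunP => i; apply/eqP.
apply: (@sum_flip_odd i) => S; rewrite !walsh_flip mulrACA -signr_addb.
by move: xyi; case: (x i); case: (y i) => // _; rewrite mulN1r.
Qed.

Definition fourier (G : {ffun I -> bool} -> R) S : R := \sum_x G x * walsh S x.

Lemma parseval G : \sum_S fourier G S ^+ 2 = (2 ^ #|I|)%:R * \sum_x G x ^+ 2.
Proof.
transitivity (\sum_x \sum_y G x * G y * \sum_S walsh S x * walsh S y).
  under eq_bigr => S _ do rewrite expr2 /fourier big_distrlr /=.
  rewrite exchange_big; apply: eq_bigr => x _ /=.
  rewrite exchange_big; apply: eq_bigr => y _ /=.
  by rewrite mulr_sumr; apply: eq_bigr => S _; rewrite mulrACA.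
rewrite mulr_sumr; apply: eq_bigr => x _.
rewrite (bigD1 x) //= walsh_orthogonal eqxx big1 => [|y yx].
  by rewrite addr0 -expr2 mulrC.
by rewrite walsh_orthogonal eq_sym (negbTE yx) mulr0.
Qed.

(** Some [i] in [S] lies outside [J]; flipping it preserves [G] and negates the character, so the
    sum cancels. *)
Lemma fourier_junta G (J : {set I}) S :
  (forall x y, {in J, x =1 y} -> G x = G y) -> (#|J| < #|[set i | S i]|)%N ->
  fourier G S = 0.
Proof.
move=> GJ ltJS; have [i Si iJ] : exists2 i, S i & i \notin J.
  have /subsetPn[i] : ~~ ([set i | S i] \subset J).
    by apply: contraTN ltJS => /subset_leq_card; rewrite -leqNgt.
  by rewrite inE; exists i.
apply: (@sum_flip_odd i) => x; rewrite walshC walsh_flip Si mulN1r mulrN walshC.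
congr (- (_ * _)); apply: GJ => j jJ; rewrite ffunE.
by case: eqP jJ iJ => [->->//|]; rewrite addbF.
Qed.

Lemma fourier_diff G i S :
  fourier (fun x => G x - G (flip x i)) S = (S i)%:R * 2 * fourier G S.
Proof.
transitivity (fourier G S - \sum_x G (flip x i) * walsh S x).
  by rewrite -sumrB; apply: eq_bigr => x _; rewrite mulrBl.
rewrite (reindex_inj (inv_inj (flipK i))) /=.
transitivity (fourier G S - (-1) ^+ S i * fourier G S).
  congr (_ - _); rewrite mulr_sumr; apply: eq_bigr => x _.
  by rewrite flipK walshC walsh_flip walshC mulrCA.
by case: (S i); rewrite /= ?mulN1r ?opprK -?mulr2n ?mul1r ?mulr_natl ?subrr ?mul0r.
Qed.

(** For values 0 and 1, the indicator of a change under a flip is the squared difference. By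
    Parseval, summing over [i] weights each squared coefficient by 4|S|, and coefficients with |S| >
    [d] vanish. *)
Lemma total_influence_cube (d N : nat) (c : 'I_N -> R)
    (g : 'I_N -> {ffun I -> bool} -> R) (G : {ffun I -> bool} -> R) :
  (forall t, exists J : {set I}, (#|J| <= d)%N /\
     forall x y, {in J, x =1 y} -> g t x = g t y) ->
  (forall x, G x = \sum_t c t * g t x) ->
  (forall x, G x = 0 \/ G x = 1) ->
  (\sum_i \sum_x (G x != G (flip x i)) <= 4 * d * 2 ^ #|I|)%N.
Proof.
move=> gJ GE G01.
have G0 S : (d < #|[set i | S i]|)%N -> fourier G S = 0.
  move=> dS; transitivity (\sum_t c t * fourier (g t) S).
    under [RHS]eq_bigr => t _ do rewrite mulr_sumr.
    rewrite exchange_big; apply: eq_bigr => x _ /=.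
    by rewrite GE mulr_suml; apply: eq_bigr => t _; rewrite mulrA.
  rewrite big1 // => t _; have [J [Jd gtJ]] := gJ t.
  by rewrite (fourier_junta gtJ) ?mulr0 // (leq_ltn_trans Jd).
rewrite -(ler_nat R) natr_sum.
have -> : \sum_i (\sum_x (G x != G (flip x i)))%:R
    = \sum_i \sum_x (G x - G (flip x i)) ^+ 2 :> R.
  apply: eq_bigr => i _; rewrite natr_sum; apply: eq_bigr => x _.
  case: (G01 x) => ->; case: (G01 (flip x i)) => ->;
    by rewrite ?eqxx ?oner_eq0 1?eq_sym ?oner_eq0 ?subrr ?subr0 ?sub0r
      ?sqrrN ?expr1n ?expr0n.
have p2 : 0 < (2 ^ #|I|)%:R :> R by rewrite ltr0n expn_gt0.
rewrite -(ler_pM2l p2) mulr_sumr.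
under eq_bigr => i _.
  rewrite -(parseval (fun x => G x - G (flip x i))).
  under eq_bigr => S _ do rewrite fourier_diff.
  over.
rewrite exchange_big /=.
apply: (@le_trans _ _ (\sum_S (4 * d)%:R * fourier G S ^+ 2)).
  apply: ler_sum => S _.
  have -> : \sum_i ((S i)%:R * 2 * fourier G S) ^+ 2
      = (4 * #|[set i | S i]|)%:R * fourier G S ^+ 2.
    under eq_bigr => i _ do rewrite exprMn.
    rewrite -mulr_suml; congr (_ * _).
    rewrite natrM -sum1_card natr_sum mulr_sumr [RHS]big_mkcond.
    apply: eq_bigr => i _; rewrite inE.
    by case: (S i); rewrite ?mul0r ?expr0n // mul1r -natrX mulr1.
  have [Sd|Sd] := leqP #|[set i | S i]| d; last by rewrite G0 // expr0n !mulr0.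
  by rewrite ler_wpM2r ?sqr_ge0 // ler_nat leq_mul2l Sd orbT.
rewrite -mulr_sumr parseval mulrCA ler_pM2l // [leRHS]natrM ler_wpM2l ?ler0n //.
apply: (@le_trans _ _ (\sum_(x : {ffun I -> bool}) 1)).
  by apply: ler_sum => x _; case: (G01 x) => ->; rewrite ?expr0n ?expr1n ?ler01.
by rewrite sumr_const card_ffun card_bool.
Qed.

End Cube.

(** * Permutations of coordinates acting on the multislice *)

Section Permute.
Variables (n ell : nat) (kappa : 'I_ell -> nat).
Implicit Types (u v w : multislice n kappa) (s t : {perm 'I_n}) (i j : 'I_n).

Lemma multisliceP u v : (forall j, u j = v j) -> u = v.
Proof. by move=> uv; apply/val_inj/ffunP. Qed.

Lemma card_letter u a : #|[set j | u j == a]| = kappa a.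
Proof. by case: u => u /= /forallP/(_ a)/eqP. Qed.

Fact mperm_subproof u s :
  [forall a, #|[set j | [ffun j => u (s j)] j == a]| == kappa a].
Proof.
apply/forallP => a; rewrite -(card_letter u a).
rewrite -(card_preimset [set j | u j == a] (@perm_inj _ s)).
apply/eqP/eq_card => j.
by rewrite !inE ffunE.
Qed.

Definition mperm u s := Multislice (mperm_subproof u s).

Lemma mpermE u s j : mperm u s j = u (s j).
Proof. by rewrite /mperm /= ffunE. Qed.

Lemma mpermM u s t : mperm u (t * s)%g = mperm (mperm u s) t.
Proof. by apply: multisliceP => j; rewrite !mpermE permM. Qed.

Lemma mperm1 u : mperm u 1%g = u.
Proof. by apply: multisliceP => j; rewrite mpermE perm1. Qed.

Lemma mperm_inj s : injective (mperm^~ s).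
Proof.
by apply: (can_inj (g := mperm^~ (s^-1)%g)) => u; rewrite -mpermM mulVg mperm1.
Qed.

(** Induction on the number of disagreements between [w] and [v]: one swap outside [A] repairs
    position [i] and spoils no other. *)
Lemma tperm_connect (A : {set 'I_n}) (P : multislice n kappa -> Prop) u v :
  (forall w i j, {in A, u =1 w} -> i \notin A -> j \notin A ->
     P w -> P (mperm w (tperm i j))) ->
  P u -> {in A, u =1 v} -> P v.
Proof.
move=> Pstep Pu uv.
suff H d w : (#|[set j | w j != v j]| <= d)%N -> {in A, u =1 w} -> P w -> P v.
  by apply: (H _ u (leqnn _)) => // j.
elim: d w => [|d IHd] w.
  rewrite leqn0 cards_eq0 => /eqP wv _; suff -> : w = v by [].
  apply: multisliceP => j; apply/eqP; apply: contraFT (in_set0 j) => wvj.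
  by rewrite -wv inE.
move=> wvd uw Pw; case: (set_0Vmem [set j | w j != v j]) => [wv0|[i]].
  by apply: IHd uw Pw; rewrite wv0 cards0.
rewrite inE => wvi.
(* The letter [v i] occurs equally often in [w] and [v], so inclusion would force equality, which
   fails at [i]. Hence [w] has this letter at some misplaced position [j]. *)
have /subsetPn[j] : ~~ ([set j | w j == v i] \subset [set j | v j == v i]).
  apply: contraNN wvi => sub.
  have /eqP e : [set j | w j == v i] == [set j | v j == v i].
    by rewrite eqEcard sub !card_letter leqnn.
  by have := in_set (fun j => v j == v i) i; rewrite -e inE eqxx.
rewrite !inE => /eqP wj vj.
have iA : i \notin A by apply: contraNN wvi => iA; rewrite -uw // uv.
have jA : j \notin A by apply: contraNN vj => jA; rewrite -wj -uw // uv.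
apply: (IHd (mperm w (tperm i j))); last exact: Pstep.
- rewrite -ltnS; apply: leq_trans wvd; apply: proper_card; apply/properP; split.
    apply/subsetP => l; rewrite !inE mpermE.
    by case: tpermP => [->|->|//]; rewrite ?wj ?eqxx // => _; rewrite eq_sym.
  by exists i; rewrite !inE // mpermE tpermL wj eqxx.
- move=> l lA; rewrite mpermE tpermD ?uw //.
    by apply: contraNneq iA => ->.
  by apply: contraNneq jA => ->.
Qed.

End Permute.

(** * Nonzero functions of low degree are nonzero on a large fraction of a fiber *)

Section Spread.
Variables (R : realType) (n ell q : nat).
Let U := multislice n (fun _ : 'I_ell => q).
Implicit Types (u v w : U) (i j : 'I_n) (A J : {set 'I_n}).

(* Degree after freezing the coordinates in [A]: juntas read them for free. *)
Definition rel_degree A k (h : U -> R) :=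
  exists N (c : 'I_N -> R) (g : 'I_N -> U -> R),
  (forall t, exists J, (#|J| <= k)%N /\
     forall u v, {in A :|: J, u =1 v} -> g t u = g t v) /\
  forall u, h u = \sum_t c t * g t u.

(** A junta reading neither [i] nor [j] cancels in the difference; any other has [i] or [j] in its
    set, and that coordinate becomes free. *)
Lemma rel_degree_diff A k h i j : i \notin A -> j \notin A ->
  rel_degree A k.+1 h ->
  rel_degree (A :|: [set i; j]) k (fun u => h u - h (mperm u (tperm i j))).
Proof.
move=> iA jA [N [c [g [gJ hE]]]].
exists N, c, (fun t u => g t u - g t (mperm u (tperm i j))); split; last first.
  by move=> u; rewrite !hE -sumrB; apply: eq_bigr => t _; rewrite mulrBr.
move=> t; have [J [Jk gtJ]] := gJ t.
have [/andP[iJ jJ]|] := boolP ((i \notin J) && (j \notin J)).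
  have inv u : g t (mperm u (tperm i j)) = g t u.
    apply: gtJ => l; rewrite inE mpermE => /orP lAJ; rewrite tpermD //.
      by case: lAJ => lA; [apply: contraNneq iA|apply: contraNneq iJ] => ->.
    by case: lAJ => lA; [apply: contraNneq jA|apply: contraNneq jJ] => ->.
  by exists set0; split; [rewrite cards0|move=> u v _; rewrite !inv !subrr].
rewrite negb_and !negbK => ijJ; exists (J :\: [set i; j]); split.
  rewrite -ltnS; apply: leq_trans Jk; apply: proper_card.
  rewrite properE subsetDl; apply/subsetPn.
  by case/orP: ijJ => lJ; [exists i|exists j]; rewrite // !inE eqxx ?orbT.
move=> u v uv; congr (_ - _); apply: gtJ => l; rewrite inE => lAJ.
  by apply: uv; rewrite !inE; move: lAJ; case: (l \in A); case: (l == i); case: (l == j).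
rewrite !mpermE; apply: uv; case: tpermP lAJ => [_|_|/eqP/negbTE li /eqP/negbTE lj];
  by rewrite !inE ?eqxx ?orbT // li lj !orbF.
Qed.

Definition fiber A w := [set u : U | [forall (j | j \in A), u j == w j]].

Lemma fiberP A w u : reflect {in A, u =1 w} (u \in fiber A w).
Proof. by rewrite inE; apply: (iffP forall_inP) => uw j /uw/eqP. Qed.

(** Double counting of pairs (u, j) with [j] outside [A] and [u j = w i]. Each [u] has at least q -
    |A| >= q/2 such [j], while by the symmetry (i j) every [j] has as many [u] as [i] does, and
    there are at most q ell choices of [j]. *)
Lemma card_fiberU1 A i w : (n <= q * ell)%N -> (0 < q)%N -> (2 * #|A| <= q)%N ->
  i \notin A -> (#|fiber A w| <= 2 * ell * #|fiber (i |: A) w|)%N.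
Proof.
move=> nq q0 Aq iA.
pose X j := [set u in fiber A w | u j == w i].
have cX j : j \notin A -> #|X j| = #|fiber (i |: A) w|.
  move=> jA; rewrite -[RHS](card_preimset _ (@mperm_inj _ _ _ (tperm i j))).
  apply: eq_card => u; rewrite [LHS]inE [RHS]inE.
  have tA l : l \in A -> tperm i j l = l.
    by move=> lA; rewrite tpermD //; [apply: contraNneq iA|apply: contraNneq jA] => ->.
  apply/andP/fiberP => [[/fiberP uw /eqP uj] l|uw].
    rewrite !inE mpermE => /predU1P[->|lA]; first by rewrite tpermL.
    by rewrite tA // uw.
  split; last by rewrite -uw ?setU11 // mpermE tpermL.
  by apply/fiberP => l lA; rewrite -uw ?setU1r // mpermE tA.
have lo : (#|fiber A w| * (q - #|A|) <= \sum_(j | j \notin A) #|X j|)%N.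
  apply: (@leq_trans (\sum_(u in fiber A w) #|[set j | u j == w i] :\: A|)%N).
    rewrite -sum_nat_const; apply: leq_sum => u _.
    by rewrite cardsD card_letter leq_sub2l // subset_leq_card // subsetIr.
  rewrite (eq_bigr (fun j => \sum_(u in fiber A w) (u j == w i))%N); last first.
    move=> j _; rewrite -sum1_card big_mkcond [RHS]big_mkcond.
    by apply: eq_bigr => u _; rewrite inE; case: (_ \in _); case: (_ == _).
  rewrite exchange_big; apply: leq_sum => u _.
  rewrite -sum1_card big_mkcond [leqRHS]big_mkcond.
  by apply: leq_sum => j _; rewrite !inE; case: (_ \in _); case: (_ == _).
have hi : (\sum_(j | j \notin A) #|X j| <= q * ell * #|fiber (i |: A) w|)%N.
  rewrite (eq_bigr _ cX) sum_nat_const leq_mul2r; apply/orP; right.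
  by apply: leq_trans nq; rewrite -[leqRHS]card_ord max_card.
by rewrite -(leq_pmul2l q0); nia.
Qed.

Lemma card_fiberU2 A i j w : (n <= q * ell)%N -> (0 < q)%N ->
  (2 * (#|A| + 1) <= q)%N -> i \notin A -> j \notin A -> i != j ->
  (#|fiber A w| <= 4 * ell ^ 2 * #|fiber (A :|: [set i; j]) w|)%N.
Proof.
move=> nq q0 Aq iA jA ij.
have jiA : j \notin i |: A by rewrite !inE negb_or eq_sym ij.
have le1 : (#|fiber A w| <= 2 * ell * #|fiber (i |: A) w|)%N.
  by apply: card_fiberU1 => //; lia.
have le2 : (#|fiber (i |: A) w| <= 2 * ell * #|fiber (j |: (i |: A)) w|)%N.
  by apply: card_fiberU1 => //; rewrite cardsU1 iA; lia.
have -> : A :|: [set i; j] = j |: (i |: A).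
  by rewrite setUC [[set i; j]]setUC setUA.
apply: leq_trans le1 _.
apply: leq_trans (leq_mul (leqnn _) le2) _.
by rewrite mulnA leq_mul2r; apply/orP; right; nia.
Qed.

(* Induction on the degree: if [h] is not constant on the fiber then some
   transposition changes it, and the difference [h - h^(ij)], once coordinates
   [i] and [j] are frozen too, is nonzero of smaller relative degree. *)
Lemma rel_degree_spread k A h w :
  (0 < ell)%N -> (n <= q * ell)%N -> (0 < q)%N ->
  (2 * (#|A| + 2 * k) <= q)%N -> rel_degree A k h -> h w != 0 ->
  (#|fiber A w| <= (8 * ell ^ 2) ^ k * #|[set u in fiber A w | h u != 0%R]|)%N.
Proof.
move=> ell0 nq q0; elim: k A h w => [|k IHk] A h w Aq dh hw.
  (* In relative degree 0 the juntas read only [A], so [h] is constant on the fiber. *)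
  rewrite mul1n subset_leq_card //; apply/subsetP => u uw; rewrite inE uw /=.
  have [N [c [g [gJ hE]]]] := dh; move: hw; rewrite !hE.
  congr (~~ (_ == _)); apply: eq_bigr => t _; congr (_ * _).
  have [J [J0 gtJ]] := gJ t; apply: gtJ => j; rewrite inE.
  move: J0; rewrite leqn0 cards_eq0 => /eqP->; rewrite inE orbF => jA.
  by rewrite (fiberP _ _ _ uw).
have [/existsP[u /andP[uw /existsP[i /existsP[j /and3P[iA jA hij]]]]]|noij] :=
  boolP [exists u, (u \in fiber A w) && [exists i, exists j,
    [&& i \notin A, j \notin A & h u != h (mperm u (tperm i j))]]]; last first.
  (* No transposition outside [A] changes [h] on the fiber, so nonvanishing propagates from [w] to
     all of it. *)
  apply: leq_trans (leq_pmull _ _); last by rewrite expn_gt0 muln_gt0 expn_gt0 ell0.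
  rewrite subset_leq_card //; apply/subsetP => v vw; rewrite inE vw /=.
  apply/eqP; apply: (@tperm_connect _ _ _ A (fun v => h v <> 0) w).
  - move=> u i j wu iA jA hu; suff <- : h u = h (mperm u (tperm i j)) by [].
    apply/eqP; apply: contraNT noij => hij; apply/existsP; exists u.
    apply/andP; split; first by apply/fiberP => l lA; rewrite wu.
    by apply/existsP; exists i; apply/existsP; exists j; rewrite iA jA.
  - exact/eqP.
  - by move=> l lA; rewrite (fiberP _ _ _ vw).
have ij : i != j by apply: contraNneq hij => ->; rewrite tperm1 mperm1.
have fE : fiber A u = fiber A w.
  apply/setP => v; apply/fiberP/fiberP => vE l lA; rewrite vE //.
    exact: (fiberP _ _ _ uw).
  by rewrite (fiberP _ _ _ uw).
have cA : (#|A :|: [set i; j]| <= #|A| + 2)%N.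
  by rewrite cardsU cards2 ij leq_subr.
pose D v := h v - h (mperm v (tperm i j)).
have := IHk (A :|: [set i; j]) D u _ (rel_degree_diff iA jA dh) _.
rewrite subr_eq0 => /(_ _ hij) leD.
rewrite -fE; apply: leq_trans (card_fiberU2 u nq q0 _ iA jA ij) _; first by lia.
have tperm_fiber v : (mperm v (tperm i j) \in fiber A u) = (v \in fiber A u).
  have tA l : l \in A -> tperm i j l = l.
    by move=> lA; rewrite tpermD //; [apply: contraNneq iA|apply: contraNneq jA] => ->.
  by apply/fiberP/fiberP => vE l lA; rewrite -vE // mpermE tA.
set B := [set v in fiber A u | h v != 0].
(* Where [D] is nonzero, [h] is nonzero at [v] or at its swap. This factor 2, times 4 ell^2 for
   freezing [i] and [j], gives 8 ell^2 per degree. *)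
have Dle : (#|[set v in fiber (A :|: [set i; j]) u | D v != 0%R]| <= 2 * #|B|)%N.
  rewrite mul2n -addnn -[X in (_ <= X + _)%N](card_preimset B
    (@mperm_inj _ _ _ (tperm i j))).
  apply: leq_trans (leq_card_setU _ _); apply/subset_leq_card/subsetP => v.
  rewrite [in X in X -> _]inE => /andP[/fiberP vE Dv].
  have vA : v \in fiber A u by apply/fiberP => l lA; rewrite vE // inE lA.
  rewrite inE [_ \in _ @^-1: _]inE ![_ \in B]inE tperm_fiber vA /=.
  rewrite -negb_and; apply: contraNN Dv => /andP[/eqP hv /eqP hv'].
  by rewrite /D hv hv' subrr.
have {}leD := leD ltac:(lia).
apply: leq_trans (leq_mul (leqnn _) (leq_trans leD (leq_mul (leqnn _) Dle))) _.
rewrite (expnS (_ * _)); move: (_ ^ k)%N #|B| => c b.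
by apply/eq_leq; ring.
Qed.

End Spread.

(** * Upper bound on the influence of transpositions *)

Section Influence.
Variables (R : realType) (n ell : nat) (kappa : 'I_ell -> nat).
Let U := multislice n kappa.
Variables (k : nat) (f : U -> R).
Hypothesis f01 : forall u, f u = 0 \/ f u = 1.
Hypothesis fk : degree_at_most k f.

Section Matching.
Variable p : 'I_n -> 'I_n.
Hypothesis pK : involutive p.
Implicit Types x : {ffun 'I_n -> bool}.

(* The exclusive or makes the cube {0,1}^n act through the matching [p]
   without choosing representatives: flipping the bit at [i] or at [p i]
   toggles the same swap. *)
Definition swap_fun x j := if x j (+) x (p j) then p j else j.

Fact swap_fun_inj x : injective (swap_fun x).
Proof.
apply: (can_inj (g := swap_fun x)) => j; rewrite /swap_fun.
case xj: (x j (+) x (p j)); last by rewrite xj.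
by rewrite pK addbC xj.
Qed.

Definition swap_perm x : {perm 'I_n} := perm (@swap_fun_inj x).

Lemma swap_perm_flip x i :
  swap_perm (flip x i) = (tperm i (p i) * swap_perm x)%g.
Proof.
apply/permP => j; rewrite permM [LHS]permE [RHS]permE /swap_fun !ffunE.
case: tpermP => [->|->|/eqP/negbTE ji /eqP/negbTE jpi].
- rewrite eqxx pK; have [pi|pi] := eqVneq (p i) i.
    by rewrite pi !if_same.
  by rewrite addbF addbT addNb [x (p i) (+) _]addbC; case: (x i (+) _).
- rewrite pK eqxx; have [pi|pi] := eqVneq (p i) i.
    by rewrite !pi !if_same.
  by rewrite addbF addbT addbN addbC; case: (x i (+) _).
- by rewrite ji (inv_eq pK) jpi !addbF.
Qed.

Lemma matching_influence :
  (\sum_i \sum_u (f u != f (mperm u (tperm i (p i)))) <= 8 * k * #|{: U}|)%N.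
Proof.
have cube u : (\sum_i \sum_x (f (mperm u (swap_perm x)) !=
    f (mperm u (swap_perm (flip x i)))) <= 4 * (2 * k) * 2 ^ n)%N.
  have [N [c [g [gJ fE]]]] := fk.
  rewrite -[X in (2 ^ X)%N]card_ord.
  apply: (total_influence_cube (c := c)
    (g := fun t x => g t (mperm u (swap_perm x)))
    (G := fun x => f (mperm u (swap_perm x)))) => [t|x|x]; last exact: f01.
    (* After the swaps, the letter at [j] depends only on the bits at [j] and [p j]; hence degree 2k
       on the cube. *)
    have [J [Jk gtJ]] := gJ t; exists (J :|: p @: J); split.
      rewrite mul2n -addnn; apply: leq_trans (leq_card_setU _ _) _.
      by rewrite leq_add // (leq_trans (leq_imset_card _ _)).
    move=> x y xy; apply: gtJ => j jJ; rewrite !mpermE !permE /swap_fun.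
    by rewrite !xy // inE ?jJ // imset_f ?orbT.
  exact: fE.
rewrite -(leq_pmul2r (expn_gt0 2 n : (0 < 2 ^ n)%N)).
apply: (@leq_trans (\sum_(u : U) 4 * (2 * k) * 2 ^ n)%N); last first.
  by rewrite sum_nat_const; apply/eq_leq; ring.
apply: (@leq_trans (\sum_(u : U) \sum_i \sum_x (f (mperm u (swap_perm x)) !=
    f (mperm u (swap_perm (flip x i)))))%N); last by apply: leq_sum => u _.
rewrite [leqRHS]exchange_big big_distrl; apply/eq_leq/eq_bigr => i _ /=.
rewrite [RHS]exchange_big /= mulnC -[X in (2 ^ X)%N]card_ord -card_bool -card_ffun.
rewrite -sum_nat_const; apply: eq_bigr => x _.
(* For fixed [x] the swaps permute the multislice, so every [x] contributes the same sum over
   [u]. *)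
rewrite (reindex_inj (@mperm_inj _ _ _ (swap_perm x))).
by apply: eq_bigr => u _; rewrite swap_perm_flip mpermM.
Qed.

End Matching.

End Influence.

Lemma total_influence (R : realType) n ell (kappa : 'I_ell -> nat) k
    (f : multislice n kappa -> R) :
  (forall u, f u = 0 \/ f u = 1) -> degree_at_most k f ->
  (\sum_i \sum_j \sum_u (f u != f (mperm u (tperm i j))) <=
    n * (8 * k * #|{: multislice n kappa}|))%N.
Proof.
case: n f => [|m] g g01 gk; first by rewrite big_ord0.
(* The maps [i |-> s - i] are [n] matchings covering each pair exactly once. *)
have pK (s : 'I_m.+1) : involutive (fun i => s - i) by move=> i; rewrite subKr.
apply: (@leq_trans (\sum_(s < m.+1) 8 * k * #|{: multislice m.+1 kappa}|)%N); last first.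
  by rewrite sum_nat_const card_ord.
apply: (@leq_trans (\sum_(s < m.+1) \sum_i \sum_u
    (g u != g (mperm u (tperm i (s - i))%R)))%N); last first.
  by apply: leq_sum => s _; apply: (matching_influence g01 gk (pK s)).
rewrite [leqRHS]exchange_big; apply/eq_leq/eq_bigr => i _ /=.
by rewrite (reindex_inj (addIr (- i))).
Qed.

(** * From few sensitive partners to a small junta *)

Lemma invariant_junta n ell (kappa : 'I_ell -> nat) (T : eqType)
    (f : multislice n kappa -> T) i :
  is_junta #|[set j | [exists u, f u != f (mperm u (tperm i j))]]| f.
Proof.
exists [set j | [exists u, f u != f (mperm u (tperm i j))]]; split=> // u v uv.
apply/esym; move: uv; set J := [set j | _] => uv.
have inv j w : j \notin J -> f (mperm w (tperm i j)) = f w.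
  rewrite inE negb_exists => /forallP/(_ w).
  by rewrite negbK => /eqP.
apply: (@tperm_connect _ _ _ J (fun w => f w = f u) u) => //.
move=> w j l _ jJ lJ <-.
have [->|ij] := eqVneq j i; first exact: inv.
have [->|il] := eqVneq l i; first by rewrite tpermC inv.
have [->|jl] := eqVneq j l; first by rewrite tperm1 mperm1.
(* Conjugating (i l) by (i j) gives (j l), a product of transpositions that fix [f]. *)
have -> : tperm j l = (tperm i j * tperm i l * tperm i j)%g.
  rewrite -{1}[tperm i j]tpermV -mulgA -/(conjg _ _) tpermJ.
  by rewrite tpermL [tperm i j l]tpermD // eq_sym.
by rewrite !mpermM inv // inv // inv.
Qed.

(** Freezing [i] and [j] costs 4 ell^2, and the difference then has relative degree k - 1, whose
    spread costs (8 ell^2)^(k-1). *)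
Lemma sensitive_pair_spread (R : realType) n ell q k
    (f : multislice n (fun _ : 'I_ell => q) -> R) i j u :
  (0 < ell)%N -> (n <= q * ell)%N -> (0 < q)%N -> (4 * k <= q)%N ->
  degree_at_most k f -> f u != f (mperm u (tperm i j)) ->
  (#|{: multislice n (fun _ : 'I_ell => q)}| <=
    (8 * ell ^ 2) ^ k * \sum_v (f v != f (mperm v (tperm i j))))%N.
Proof.
move=> ell0 nq q0 kq fk fij.
have fk0 : rel_degree set0 k f.
  have [N [c [g [gJ fE]]]] := fk; exists N, c, g; split=> // t.
  have [J [Jk gtJ]] := gJ t; exists J; split=> // v w vw; apply: gtJ => l lJ.
  by apply: vw; rewrite set0U.
have ij : i != j by apply: contraNneq fij => ->; rewrite tperm1 mperm1.
case: k kq {fk} fk0 => [|k] kq fk.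
  move: fij; have [N [c [g [gJ fE]]]] := fk; rewrite !fE.
  rewrite (_ : \sum_t _ = \sum_t c t * g t (mperm u (tperm i j))) ?eqxx //.
  apply: eq_bigr => t _; have [J [J0 gtJ]] := gJ t; congr (_ * _); apply: gtJ => l.
  by move: J0; rewrite leqn0 cards_eq0 => /eqP->; rewrite setU0 inE.
have i0 : i \notin (set0 : {set 'I_n}) by rewrite inE.
have j0 : j \notin (set0 : {set 'I_n}) by rewrite inE.
have cij : (2 * (#|set0 :|: [set i; j]| + 2 * k) <= q)%N.
  by rewrite set0U cards2 ij; lia.
have Dle := rel_degree_spread (w := u) ell0 nq q0 cij (rel_degree_diff i0 j0 fk).
rewrite subr_eq0 in Dle; have {}Dle := Dle fij.
have Ule : (#|{: multislice n (fun _ : 'I_ell => q)}| <=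
    4 * ell ^ 2 * #|fiber (set0 :|: [set i; j]) u|)%N.
  apply: leq_trans (card_fiberU2 u nq q0 _ i0 j0 ij); last by rewrite cards0; lia.
  by apply/subset_leq_card/subsetP => v _; apply/fiberP => l; rewrite inE.
set S := (\sum_v _)%N; set B := [set v in _ | _] in Dle.
have BS : (#|B| <= S)%N.
  rewrite -sum1_card big_mkcond; apply: leq_sum => v _.
  by rewrite inE subr_eq0; case: (_ != _); rewrite ?andbF //; case: ifP.
apply: leq_trans Ule _.
apply: leq_trans (leq_mul (leqnn _) (leq_trans Dle (leq_mul (leqnn _) BS))) _.
rewrite (expnS (_ * _)) mulnA leq_mul2r; apply/orP; right.
by rewrite !leq_mul2r !orbT.
Qed.

Lemma junta_bound ell k : (2 <= ell)%N ->
  (8 * k * (8 * ell ^ 2) ^ k <= ell ^ (9 * k))%N.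
Proof.
move=> ell2; case: k => [|k]; first by rewrite muln0 mul0n.
have k2 : (k.+1 <= 2 ^ k)%N by apply: ltn_expl.
have p2 m : (2 ^ m <= ell ^ m)%N.
  by elim: m => // m IHm; rewrite !expnS leq_mul.
(* The three exponents pay for 8k <= 2^(4k), 8^k = 2^(3k) and ell^(2k), with [k.+1] in the role of
   k. *)
have -> : (9 * k.+1 = (4 * k.+1 + 3 * k.+1) + 2 * k.+1)%N by lia.
rewrite !expnD expnMn mulnA -expnM leq_mul2r; apply/orP; right.
apply: leq_mul; apply: leq_trans (p2 _); last by rewrite [leqRHS]expnM.
have -> : (4 * k.+1 = k + (3 * k + 4))%N by lia.
rewrite expnD mulnC; apply: leq_trans (leq_mul k2 (leqnn 8)) _.
by rewrite leq_mul2l -[8%N]/(2 ^ 3)%N leq_exp2l // orbC; lia.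
Qed.

Theorem theorem4p26 :
  exists C : nat, forall (R : realType) (ell n k : nat),
    (2 <= ell)%N -> (0 < n)%N -> (ell %| n)%N ->
    forall f : multislice n (fun _ : 'I_ell => (n %/ ell)%N) -> R,
      (forall u, f u = 0 \/ f u = 1) ->
      degree_at_most k f ->
      is_junta (ell ^ (C * k))%N f.
Proof.
exists 9%N => R ell n k ell2 n0 elln f f01 fk.
have is_juntaS a b : (a <= b)%N -> is_junta a f -> is_junta b f.
  by move=> ab [J [Ja fJ]]; exists J; split=> //; apply: leq_trans ab.
have bound := junta_bound k ell2.
have nq := divnK elln; have ell0 : (0 < ell)%N by apply: leq_trans ell2.
move: (n %/ ell)%N nq f f01 fk is_juntaS => q nq f f01 fk is_juntaS.
have q0 : (0 < q)%N by move: n0; rewrite -nq muln_gt0 => /andP[].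
have [qk|kq] := ltnP q (4 * k).
  apply: (is_juntaS n); last first.
    exists setT; split; first by rewrite cardsT card_ord.
    by move=> u v uv; congr f; apply: multisliceP => j; apply: uv; rewrite inE.
  rewrite -nq; apply: leq_trans bound.
  case: k qk {fk} => [|k] qk; first by rewrite muln0 in qk.
  have e1 : (1 <= (8 * ell ^ 2) ^ k)%N by rewrite expn_gt0 muln_gt0 expn_gt0 ell0.
  by rewrite expnS; nia.
(* Nonemptiness of the multislice makes the final count strict. *)
have [U0|U0] := posnP #|{: multislice n (fun _ : 'I_ell => q)}|.
  exists set0; split; first by rewrite cards0.
  by move=> u; have := card0_eq U0 u; rewrite inE.
pose bad i := [set j | [exists u, f u != f (mperm u (tperm i j))]].
have [/existsP[i ilow]|hi] :=
  boolP [exists i, #|bad i| <= 8 * k * (8 * ell ^ 2) ^ k]%N.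
  exact: is_juntaS (leq_trans ilow bound) (invariant_junta f i).
have := total_influence f01 fk.
rewrite leqNgt => /negP[].
set V := #|_| in U0 *; set c := ((8 * ell ^ 2) ^ k)%N in hi bound *.
have c0 : (0 < c)%N by rewrite expn_gt0 muln_gt0 expn_gt0 ell0.
(* If every [bad i] has more than 8kc elements, then, each bad pair having influence at least V / c,
   the total exceeds 8knV. *)
rewrite -(ltn_pmul2l c0).
apply: (@leq_trans (\sum_i #|bad i| * V)%N).
  apply: (@leq_trans (\sum_(i < n) (8 * k * c).+1 * V)%N).
    by rewrite sum_nat_const card_ord; nia.
  apply: leq_sum => i _; rewrite leq_mul2r; apply/orP; right.
  by rewrite ltnNge; move: hi; rewrite negb_exists => /forallP.
rewrite big_distrr; apply: leq_sum => i _ /=.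
rewrite -sum_nat_const big_distrr big_mkcond; apply: leq_sum => j _ /=.
case: ifP => //; rewrite inE => /existsP[u fu].
by apply: (sensitive_pair_spread (u := u)) => //; rewrite nq.
Qed.
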